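(* For terms $\tau_1,\tau_2$ write $\mathsf{notC}(\tau_1,\tau_2)$ for $c(\tau_1)\wedge c(\tau_2)\wedge\neg c(\tau_1+\tau_2)$. Let $\phi^c_\infty$ be the $\mathcal{B}c$-formula in the variables $r_i,r'_i,s_i,t_i$ ($0\le i\le 3$), $s$, $t$, that is the conjunction of the following, with indices modulo 4 and $[k]=k\bmod 4$: (1) $r_0+r_1+r_2+r_3=1$, $r_i\cdot r_j=0$ for $0\le i<j\le 3$, $r_i\ne 0$ for $0\le i\le 3$; (2) for $i\in\{0,1\}$: $\mathsf{notC}(r_i\cdot(-r'_i)+t,\ r'_{i+2}+s)$, $\mathsf{notC}(r'_i+s,\ r_{i+2}\cdot(-r'_{i+2})+t)$, $\mathsf{notC}(r'_i+s_i,\ r'_{i+2}+s_{i+2})$, $\mathsf{notC}(r_i\cdot(-r'_i)+t_i,\ r_{i+2}\cdot(-r'_{i+2})+t_{i+2})$; (3) $r'_i\ne 0$ and $r'_i\le r_i$ for $0\le i\le 3$, and $t\ne 0$; (4) $c(r'_i+r_{[i+1]}+t)$ for $0\le i\le 3$; (5) $\mathsf{notC}(r'_0+r'_1+r'_2+r'_3,\ t)$; (6) $\mathsf{notC}(r'_i+s,\ r_{[i+1]}\cdot(-r'_{[i+1]})+t)$ for $0\le i\le 3$. Then $\phi^c_\infty$ is satisfiable over ${\sf RC}(\mathbb{R}^n)$ for every $n\ge 2$. On the other hand, if $T$ is a locally connected, unicoherent topological space, then in any interpretation over $(T,{\sf RC}(T))$ satisfying $\phi^c_\infty$, at least one variable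 is assigned a set with infinitely many connected components.
   Context: For a topological space $T$, ${\sf RC}(T)$ is the Boolean algebra of regular closed subsets of $T$ with $X+Y=X\cup Y$, $X\cdot Y=\overline{\mathrm{int}(X\cap Y)}$, $-X=\overline{T\setminus X}$, $0=\emptyset$, $1=T$. Terms are built from variables using $+,\cdot,-,0,1$. The language $\mathcal{B}c$ has atomic formulas $\tau_1=\tau_2$ and $c(\tau)$, closed under Boolean connectives; $\tau\ne 0$ abbreviates $\neg(\tau=0)$ and $\tau_1\le\tau_2$ abbreviates $\tau_1\cdot\tau_2=\tau_1$. In an interpretation assigning elements of ${\sf RC}(T)$ to variables, $c(\tau)$ holds iff the value of $\tau$ is connected. Satisfiable over ${\sf RC}(\mathbb{R}^n)$ means true in some interpretation over ${\sf RC}(\mathbb{R}^n)$. Locally connected: every neighbourhood of each point includes a connected neighbourhood of it. Unicoherent: for closed connected $X_1,X_2$ with $T=X_1\cup X_2$, $X_1\cap X_2$ is connected. *)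

(* Defs.v *)
From HB Require Import structures.
From mathcomp Require Import all_boot all_order all_algebra.
From mathcomp Require Import all_classical all_reals all_analysis.
Set Implicit Arguments. Unset Strict Implicit. Unset Printing Implicit Defensive.
Import Order.TTheory GRing.Theory Num.Theory.
Local Open Scope classical_set_scope.

Section RC.
Variable T : topologicalType.
Implicit Types X Y : set T.

Definition regular_closed X := closure (interior X) = X.

Definition rc_plus X Y : set T := X `|` Y.
Definition rc_mul X Y : set T := closure (interior (X `&` Y)).
Definition rc_neg X : set T := closure (~` X).
Definition rc_le X Y : Prop := rc_mul X Y = X.

Definition notC X Y : Prop :=
  connected X /\ connected Y /\ ~ connected (rc_plus X Y).

Definition locally_connected_space : Prop :=
  forall (x : T) (U : set T), nbhs x U ->
    exists V : set T, [/\ nbhs x V, connected V & V `<=` U].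

Definition unicoherent : Prop :=
  forall X1 X2 : set T, closed X1 -> closed X2 -> connected X1 -> connected X2 ->
    X1 `|` X2 = setT -> connected (X1 `&` X2).

Definition components X : set (set T) :=
  [set C | exists2 x, X x & C = connected_component X x].

Definition infinitely_many_components X : Prop := ~ finite_set (components X).
End RC.

Definition shift4 (i : 'I_4) (k : nat) : 'I_4 :=
  Ordinal (ltn_pmod (i + k) (isT : (0 < 4)%N)).

Inductive var := vr of 'I_4 | vr' of 'I_4 | vs of 'I_4 | vt of 'I_4 | vS | vT.

Section Phi.
Variable T : topologicalType.
Variable a : var -> set T.
Let r i := a (vr i).
Let r' i := a (vr' i).
Let s_ i := a (vs i).
Let t_ i := a (vt i).
Let s := a vS.
Let t := a vT.
Let i2 i := shift4 i 2.
Let i1 i := shift4 i 1.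

Definition phi_c_inf : Prop :=
  [/\ rc_plus (rc_plus (rc_plus (r (inord 0)) (r (inord 1))) (r (inord 2))) (r (inord 3)) = setT,
      (forall i j : 'I_4, (i < j)%N -> rc_mul (r i) (r j) = set0)
    & (forall i, r i <> set0)] /\
  (forall i : 'I_4, (i < 2)%N ->
    [/\ notC (rc_plus (rc_mul (r i) (rc_neg (r' i))) t) (rc_plus (r' (i2 i)) s),
        notC (rc_plus (r' i) s) (rc_plus (rc_mul (r (i2 i)) (rc_neg (r' (i2 i)))) t),
        notC (rc_plus (r' i) (s_ i)) (rc_plus (r' (i2 i)) (s_ (i2 i)))
      & notC (rc_plus (rc_mul (r i) (rc_neg (r' i))) (t_ i))
             (rc_plus (rc_mul (r (i2 i)) (rc_neg (r' (i2 i)))) (t_ (i2 i)))]) /\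
  (forall i, r' i <> set0 /\ rc_le (r' i) (r i)) /\ t <> set0 /\
  (forall i, connected (rc_plus (rc_plus (r' i) (r (i1 i))) t)) /\
  notC (rc_plus (rc_plus (rc_plus (r' (inord 0)) (r' (inord 1))) (r' (inord 2))) (r' (inord 3))) t /\
  (forall i, notC (rc_plus (r' i) s) (rc_plus (rc_mul (r (i1 i)) (rc_neg (r' (i1 i)))) t)).
End Phi.

Definition rc_interp (T : topologicalType) (a : var -> set T) : Prop :=
  forall v, regular_closed (a v).

(* Main.v *)
(* Unsatisfiability with finitely many components: [notC] forces the two regions
   to be disjoint, so [r_i] does not meet [r_(i+2)], and [r'_i] meets neither [t]
   nor [r_(i+1) . (- r'_(i+1))].  By (4) every component of [r_i] meeting [r'_i]
   then meets a component of [r_(i+1)] that meets [r'_(i+1)], which produces an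
   infinite walk X_0, X_1, ... of components.  The boundary of a component of the
   complement of X_i is connected by unicoherence, and it lies in the union of the
   disjoint sets [r_(i-1)] and [r_(i+1)], hence in one of them.  So after moving
   from X_i to X_(i+1) the walk can only come back to X_i from an [r_(i+1)] side,
   whereas it would have to arrive from [r_(i-1)]: the X_(4k) are distinct.

   Satisfiability: cut the plane of the first two coordinates into unit squares
   and let [r_i] be the union of the square rings around the origin whose index is
   i mod 4.  On unions of squares the Boolean operations are set operations on the
   indices in Z^2, connectedness follows from paths of touching squares, and two
   unions are disjoint when no square of one touches a square of the other. *)
Require Import Defs.
From HB Require Import structures.
From mathcomp Require Import all_boot all_order all_algebra.
From mathcomp Require Import all_classical all_reals all_analysis.
From mathcomp Require Import zify lra.
Set Implicit Arguments. Unset Strict Implicit. Unset Printing Implicit Defensive.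
Import Order.TTheory GRing.Theory Num.Theory.
Import numFieldNormedType.Exports.
Local Open Scope classical_set_scope.

(** * Components in locally connected unicoherent spaces *)

Lemma connected_sub_closed (T : topologicalType) (A B C : set T) :
  connected A -> closed B -> closed C -> A `<=` B `|` C ->
  A `&` B `&` C = set0 -> A `&` B !=set0 -> A `<=` B.
Proof.
move=> cA clB clC AU AI A0 x Ax.
suff e : A `&` B = A by move: Ax; rewrite -e => -[].
apply: cA => //; last by exists B.
exists (~` C); first exact: closed_openC.
apply/seteqP; split=> y [Ay Hy]; split=> //.
  by move=> Cy; have : set0 y by rewrite -AI.
by case: (AU y Ay).
Qed.

Lemma connected_sub_open (T : topologicalType) (A D : set T) :
  connected A -> open D -> A `&` (closure D `\` D) = set0 ->
  A `&` D !=set0 -> A `<=` D.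
Proof.
move=> cA oD AI A0 x Ax.
suff e : A `&` D = A by move: Ax; rewrite -e => -[].
apply: cA => //; first by exists D.
exists (closure D); first exact: closed_closure.
apply/seteqP; split=> y [Ay Hy]; split=> //; first exact: subset_closure.
by apply: contrapT => nDy; have : set0 y by rewrite -AI.
Qed.

Lemma notC_disjoint (T : topologicalType) (X Y : set T) (x : T) :
  notC X Y -> X x -> Y x -> False.
Proof. by move=> [cX [cY nc]] Xx Yx; apply: nc; apply: connectedU => //; exists x. Qed.

Lemma connected_component_eq (T : topologicalType) (A : set T) (x y z : T) :
  connected_component A x z -> connected_component A y z ->
  connected_component A x = connected_component A y.
Proof.
by move=> /same_connected_component -> /same_connected_component ->.
Qed.

(** The remaining components are finitely many closed sets. *)
Lemma closed_setD_component (T : topologicalType) (A : set T) (x : T) :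
  closed A -> finite_set (components A) ->
  closed (A `\` connected_component A x).
Proof.
move=> clA fin.
have -> : A `\` connected_component A x =
    \bigcup_(C in components A `\` [set connected_component A x]) C.
  apply/seteqP; split=> y.
    move=> [Ay nxy]; exists (connected_component A y); last first.
      exact: connected_component_refl.
    split; first by exists y.
    by move=> /= e; apply: nxy; rewrite -e; exact: connected_component_refl.
  move=> [C [[z Az ->] /= ne] zy]; split.
    exact: connected_component_sub zy.
  by move=> xy; apply: ne; apply: connected_component_eq zy xy.
apply: closed_bigcup; first exact: finite_setD.
by move=> C [[z Az ->] _]; exact: component_closed.
Qed.

(** * Frontiers of the components of a complement *)

Section Boundary.
Variable T : topologicalType.
Hypothesis lcT : locally_connected_space T.

Lemma open_component (U : set T) (x : T) :
  open U -> open (connected_component U x).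
Proof.
move=> oU; rewrite openE => y xy.
have Uy := connected_component_sub xy.
have [V [nV cV VU]] := lcT (open_nbhs_nbhs (conj oU Uy)).
apply: filterS (nV); rewrite (same_connected_component xy).
by apply: connected_component_max => //; exact: nbhs_singleton.
Qed.

Hypothesis cT : connected [set: T].
Variable X : set T.
Hypotheses (clX : closed X) (cX : connected X) (X0 : X !=set0).

Let hole (x : T) := connected_component (~` X) x.

(** A frontier point outside [X] would have an open hole of its own, which would meet [hole x] and
    hence equal it. *)
Lemma boundary_hole_sub (x : T) : closure (hole x) `\` hole x `<=` X.
Proof.
move=> y [cy ny]; apply: contrapT => nXy; apply: ny.
have oy : open (hole y) by apply: open_component; exact: closed_openC.
have yy : hole y y by exact: connected_component_refl.
have [z [xz yz]] := cy _ (open_nbhs_nbhs (conj oy yy)).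
by rewrite /hole (connected_component_eq xz yz).
Qed.

(** With empty frontier, [hole x] would be clopen in a connected space and so contain the points of
    [X]. *)
Lemma boundary_hole_nonempty (x : T) :
  ~ X x -> closure (hole x) `\` hole x !=set0.
Proof.
move=> nXx; apply/set0P/eqP => e.
have [y Xy] := X0.
have oD : open (hole x) by apply: open_component; exact: closed_openC.
have xx : hole x x by exact: connected_component_refl.
suff : hole x y by move=> /connected_component_sub.
suff : [set: T] `<=` hole x by exact.
apply: (connected_sub_open cT oD).
  by rewrite e setI0.
by exists x.
Qed.

Hypothesis uT : unicoherent T.

(** Unicoherence is applied to [closure (hole x)] and to the complement of [hole x], which together
    cover the space. *)
Lemma connected_boundary_hole (x : T) :
  ~ X x -> connected (closure (hole x) `\` hole x).
Proof.
move=> nXx; have [x0 Xx0] := X0.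
have oD : open (hole x) by apply: open_component; exact: closed_openC.
rewrite setDE; apply: uT.
- exact: closed_closure.
- exact: open_closedC.
- apply: connected_closure; exact: component_connected.
(* The complement of the hole is [X] together with the closures of the other holes, each of which
   meets [X] in its frontier. For [y] in [X] the component is empty and the term is [X] alone. *)
- have -> : ~` hole x = \bigcup_(y in ~` hole x) (X `|` closure (hole y)).
    apply/seteqP; split=> y.
      move=> nxy; exists y => //; have [Xy|nXy] := pselect (X y); [by left|right].
      by apply: subset_closure; exact: connected_component_refl.
    move=> [z nxz [Xy|zy]] xy; first exact: (connected_component_sub xy).
    have [hy|nhy] := pselect (hole z y).
      have nXz : ~ X z.
        by move=> Xz; move: hy; rewrite /hole connected_component_out //; apply.
      apply: nxz; rewrite /hole (connected_component_eq xy hy).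
      exact: connected_component_refl.
    by apply: (connected_component_sub xy); apply: (@boundary_hole_sub z).
  apply: bigcup_connected; first by exists x0 => y _; left.
  move=> y _; have [Xy|nXy] := pselect (X y).
    by rewrite /hole connected_component_out ?closure0 ?setU0//; apply.
  apply: connectedU => //; last first.
    by apply: connected_closure; exact: component_connected.
  have [z bz] := boundary_hole_nonempty nXy.
  by exists z; split; [exact: boundary_hole_sub bz|case: bz].
- apply/seteqP; split=> y // _; have [h|h] := pselect (hole x y); [left|by right].
  exact: subset_closure.
Qed.
End Boundary.

(** * Infinite walks through components of a cyclic cover *)

Section Walk.
Variable T : topologicalType.
Hypotheses (lcT : locally_connected_space T) (uT : unicoherent T).
Hypothesis cT : connected [set: T].
Variable r : nat -> set T.
Hypothesis clr : forall k, closed (r k).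
Hypothesis rmod : forall m n, m = n %[mod 4] -> r m = r n.
Hypothesis rdis : forall m n x, m = n + 2 %[mod 4] -> r m x -> r n x -> False.
Hypothesis rcov : forall k x, [\/ r k x, r k.+1 x, r k.+2 x | r k.+3 x].
Hypothesis rfin : forall k, finite_set (components (r k)).
Variable x : nat -> T.
Hypothesis xr : forall k, r k (x k).

(** With the next hypothesis, [x k] is a point where [X k] meets [X k.+1]. *)
Let X k := connected_component (r k) (x k).
Hypothesis Xx : forall k, X k.+1 (x k).

Let hole k y := connected_component (~` X k) y.
Let bd k y := closure (hole k y) `\` hole k y.

Let Xr k : X k `<=` r k. Proof. exact: connected_component_sub. Qed.
Let XX k : X k (x k). Proof. exact: connected_component_refl. Qed.
Let clX k : closed (X k). Proof. exact: component_closed. Qed.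
Let cX k : connected (X k). Proof. exact: component_connected. Qed.
Let X0 k : X k !=set0. Proof. by exists (x k). Qed.

Let bdX k y : bd k y `<=` X k.
Proof. exact: boundary_hole_sub. Qed.

Let bd0 k y : ~ X k y -> bd k y !=set0.
Proof. exact: boundary_hole_nonempty. Qed.

Let sub_hole k y (A : set T) z : ~ X k y -> connected A -> A z -> hole k y z ->
  (forall w, A w -> bd k y w -> False) -> A `<=` hole k y.
Proof.
move=> nXy cA Az hz Abd; apply: connected_sub_open => //.
- by apply: open_component => //; exact: closed_openC.
- by apply/seteqP; split=> w // [Aw bw]; exact: Abd bw.
- by exists z.
Qed.

(** Near a frontier point the hole avoids [X k] and also the other components of [r k], whose union
    is closed; so the point is a limit of the other three sets. Being in [r k], it is not in
    [r k.+2]. Connectedness of the frontier then selects one of the two disjoint closed sets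
    left. *)
Let bd_side k y : ~ X k y -> bd k y `<=` r k.+1 \/ bd k y `<=` r k.+3.
Proof.
move=> nXy.
have cbd : connected (bd k y) by exact: connected_boundary_hole.
have sub : bd k y `<=` r k.+1 `|` r k.+3.
  move=> p bp; have Xp := bdX bp.
  have clO : closed (r k `\` X k) by exact: closed_setD_component.
  have : closure (r k.+1 `|` r k.+2 `|` r k.+3) p.
    move=> B nB; have nO : nbhs p (~` (r k `\` X k)).
      by apply: open_nbhs_nbhs; split; [exact: closed_openC|case].
    have [z [hz [Bz nz]]] := bp.1 _ (filterI nB nO).
    exists z; split => //; have nXz := connected_component_sub hz.
    case: (rcov k z) => rz; [|by left; left|by left; right|by right].
    by exfalso; apply: nz.
  rewrite -(closure_id _).1; last by do !apply: closedU.
  move=> [[|rp]|]; [by left|exfalso|by right].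
  by apply: (@rdis k.+2 k p) => //; [rewrite addn2|exact: Xr].
have dis : r k.+1 `&` r k.+3 = set0.
  apply/seteqP; split=> z // [z1 z3].
  by apply: (@rdis k.+3 k.+1 z) => //; rewrite addn2.
have [p bp] := bd0 nXy.
case: (sub p bp) => rp; [left|right].
- apply: (connected_sub_closed cbd (@clr k.+1) (@clr k.+3)) => //.
    by rewrite -setIA dis setI0.
  by exists p.
- apply: (connected_sub_closed cbd (@clr k.+3) (@clr k.+1)).
  + by rewrite setUC.
  + by rewrite -setIA (setIC (r k.+3)) dis setI0.
  + by exists p.
Qed.

Let same_hole k y z : hole k y z -> hole k y = hole k z.
Proof. exact: same_connected_component. Qed.

Let Xdis m n z : m = n + 2 %[mod 4] -> X m z -> X n z -> False.
Proof. by move=> mn /Xr mz /Xr nz; exact: rdis mn mz nz. Qed.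

(* Once the walk has left [X i] for [X i.+1], it stays in the holes of [X i]
   bordered by [r i.+1], until it meets [X i] again. *)
Let walk_in_hole i m : i < m ->
  (forall l, i < l -> l <= m -> l = i %[mod 4] -> X i `&` X l = set0) ->
  forall y, X m y -> ~ X i y -> bd i y `<=` r i.+1.
Proof.
elim: m => // m IH im noret y Xy nXy.
(* Base case: if the frontier were in [r i.+3], then [X i.+1] would avoid it and lie in the hole,
   although it contains the point [x i] of [X i]. *)
have [eim|nim] := eqVneq i m.
  subst m; have [//|b3] := bd_side nXy; exfalso.
  have : hole i y (x i).
    apply: (sub_hole nXy (cX (k := i.+1)) Xy) => //.
      exact: connected_component_refl.
    move=> w /Xr w1 /b3 w3; apply: (@rdis i.+3 i.+1 w) => //.
    by rewrite addn2.
  by move=> /connected_component_sub; apply; exact: XX.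
have im' : i < m by rewrite ltn_neqAle nim.
have noret' l : i < l -> l <= m.+1 -> l = i %[mod 4] -> forall w, X i w -> X l w -> False.
  move=> il lm li w Xw Xlw; have : set0 w by rewrite -(noret l il lm li).
  by [].
set p := x m.
(* One of [m] and [m.+1] has the parity of [i]. As [p] lies in both components, either [noret'] or
   disjointness excludes it from [X i]. *)
have nXp : ~ X i p.
  move=> Xp; have /orP[/orP[/eqP e|/eqP e]|/orP[/eqP e|/eqP e]] :
    (m == i %[mod 4]) || (m.+1 == i %[mod 4]) ||
    ((m == i + 2 %[mod 4]) || (m.+1 == i + 2 %[mod 4])) by lia.
  - exact: (noret' m im' (leqnSn m) e p Xp (XX m)).
  - exact: (noret' m.+1 _ _ e p Xp (@Xx m)).
  - exact: Xdis e (XX m) Xp.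
  - exact: Xdis e (@Xx m) Xp.
have bp : bd i p `<=` r i.+1.
  by apply: IH => // l il lm; apply: noret => //; exact: leqW.
have same : X m.+1 `<=` hole i p -> bd i y `<=` r i.+1.
  by move=> /(_ _ Xy) /same_hole e; rewrite /bd -e.
have hpp : hole i p p by exact: connected_component_refl.
have hyy : hole i y y by exact: connected_component_refl.
(* If [X m.+1] avoids the frontier of the hole of [p], it stays in that hole. Otherwise it touches a
   set contained in both [X i] and [r i.+1], which forces [m.+1] to be congruent to [i.+1]; then it
   avoids any frontier lying in [r i.+3]. *)
have [[w [Xw bw]]|noX] := pselect (X m.+1 `&` bd i p !=set0); last first.
  apply: same; apply: (sub_hole nXp (cX (k := m.+1)) (Xx m) hpp).
  by move=> w Xw bw; apply: noX; exists w.
have [//|b3] := bd_side nXy.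
have mi : m.+1 = i.+1 %[mod 4].
  have /orP[/orP[/eqP e|/eqP e]|/orP[/eqP e|/eqP e]] :
    (m.+1 == i %[mod 4]) || (m.+1 == i.+1 %[mod 4]) ||
    ((m.+1 == i + 2 %[mod 4]) || (m.+1 == i.+1 + 2 %[mod 4])) by lia.
  - by exfalso; apply: (noret' m.+1 _ _ e w) => //; exact: bdX bw.
  - exact: e.
  - by exfalso; apply: Xdis e Xw _; exact: bdX bw.
  - by exfalso; apply: rdis e (Xr Xw) _; exact: bp.
have yp : hole i y p.
  apply: (sub_hole nXy (cX (k := m.+1)) Xy hyy _ (Xx m)).
  move=> v /Xr v1 /b3 v3; apply: (@rdis i.+3 m.+1 v) => //; lia.
by rewrite /bd (same_hole yp).
Qed.

(** At a first return [X j] equals [X i]. The component just before it lies in [r i.+3], so it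
    misses the frontier, which is in [r i.+1], and stays inside the hole; yet it meets [X j]. *)
Let no_return i j : i < j -> j = i %[mod 4] -> X i `&` X j = set0.
Proof.
elim/ltn_ind: j => j IH ij ji; apply/seteqP; split=> // w [Xiw Xjw].
exfalso; have {w Xiw Xjw} Xij : X i = X j.
  by move: Xiw Xjw; rewrite /X (rmod ji); exact: connected_component_eq.
have [m jm] : exists m, j = m.+2 by exists j.-2; lia.
subst j; have im : i < m by lia.
have mi : m = i + 2 %[mod 4] by lia.
have nXp : ~ X i (x m) by move=> /(Xdis mi (XX m)).
have bp : bd i (x m) `<=` r i.+1.
  by apply: (walk_in_hole im) => // l il lm li; apply: IH => //; lia.
have : hole i (x m) (x m.+1).
  apply: (sub_hole nXp (cX (k := m.+1)) (Xx m)) => //.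
    exact: connected_component_refl.
  by move=> v /Xr v1 /bp v3; apply: rdis v1 v3; lia.
by move=> /connected_component_sub; apply; rewrite Xij; exact: Xx.
Qed.

(** The sets [X (4 * k)] are pairwise distinct members of the finite set [components (r 0)]. *)
Lemma no_infinite_walk : False.
Proof.
have F : finite_set ((fun k => X (4 * k)) @^-1` components (r 0)).
  apply: finite_preimage; last exact: rfin.
  move=> k l _ _ e; apply/eqP; apply: contrapT => /negP nkl.
  have [kl|lk] : k < l \/ l < k by lia.
    have : set0 (x (4 * k)).
      by rewrite -(@no_return (4 * k) (4 * l)); [split=> //; rewrite -e|lia|lia].
    by [].
  have : set0 (x (4 * k)).
    by rewrite -(@no_return (4 * l) (4 * k)); [split=> //; rewrite -e|lia|lia].
  by [].
apply: infinite_nat; apply: sub_finite_set F => k _ /=.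
have e : r (4 * k) = r 0 by apply: rmod; lia.
by exists (x (4 * k)); [rewrite -e|rewrite /X e].
Qed.
End Walk.

(** * From a satisfying interpretation to a walk *)

Lemma rc_mul_sub (T : topologicalType) (X Y : set T) :
  closed Y -> rc_mul X Y `<=` Y.
Proof.
move=> clY; rewrite /rc_mul [X in _ `<=` X](closure_id _).1 //.
by apply: closureS => x /interior_subset [].
Qed.

(** Regularity puts interior points of [X] in every neighbourhood of [x], and they can be chosen
    outside the closed set [Y]. *)
Lemma rc_mul_negP (T : topologicalType) (X Y : set T) (x : T) :
  regular_closed X -> closed Y -> X x -> ~ Y x -> rc_mul X (rc_neg Y) x.
Proof.
move=> rX clY; rewrite -{1}rX => Xx nYx B nB.
have nY : nbhs x (~` Y) by apply: open_nbhs_nbhs; split=> //; exact: closed_openC.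
have [z [iz [Bz nYz]]] := Xx _ (filterI nB nY).
exists z; split=> //; rewrite /interior /=.
have : nbhs z (X^° `&` ~` Y).
  by apply: open_nbhs_nbhs; split=> //; apply: openI; [exact: open_interior|exact: closed_openC].
apply: filterS => w [iw nw]; split; first exact: interior_subset iw.
exact: subset_closure.
Qed.

Lemma phi_c_inf_infinitely_many_components (T : topologicalType) (a : var -> set T) :
  locally_connected_space T -> unicoherent T -> rc_interp a -> phi_c_inf a ->
  exists v : var, infinitely_many_components (a v).
Proof.
move=> lcT uT ra [[cov _ _] [dis2 [r'r [t0 [cr [notr't notr'q]]]]]].
apply: contrapT => nex.
have fin v : finite_set (components (a v)).
  by apply: contrapT => nf; apply: nex; exists v.
have cl v : closed (a v) by rewrite -(ra v); exact: closed_closure.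
pose o k : 'I_4 := inord (k %% 4).
have oE k : (o k : nat) = k %% 4 by rewrite inordK // ltn_mod.
have oS k c : shift4 (o k) c = o (k + c).
  by apply: val_inj; rewrite /= !oE modnDml.
have oI (i : 'I_4) : i = o i by apply: val_inj; rewrite /= oE modn_small.
have r'_r i : a (vr' i) `<=` a (vr i).
  by rewrite -(r'r i).2; apply: rc_mul_sub.
have r_split i x : a (vr i) x ->
    a (vr' i) x \/ rc_mul (a (vr i)) (rc_neg (a (vr' i))) x.
  move=> rx; have [|nx] := pselect (a (vr' i) x); [by left|right].
  exact: rc_mul_negP.
have r_dis (i : 'I_4) x : i < 2 -> a (vr i) x -> a (vr (shift4 i 2)) x -> False.
  move=> i2 /r_split ri /r_split rj; have [n1 n2 n3 n4] := dis2 i i2.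
  case: ri rj => [ri|ri] [rj|rj].
  - by apply: (notC_disjoint n3 (x := x)); left.
  - by apply: (notC_disjoint n2 (x := x)); left.
  - by apply: (notC_disjoint n1 (x := x)); left.
  - by apply: (notC_disjoint n4 (x := x)); left.
have inords x : (exists i, a (vr' i) x) ->
   rc_plus (rc_plus (rc_plus (a (vr' (inord 0))) (a (vr' (inord 1))))
     (a (vr' (inord 2)))) (a (vr' (inord 3))) x.
  move=> [i r'x]; rewrite (oI i) /o in r'x.
  move: (ltn_ord i) r'x; case: (nat_of_ord i) => [|[|[|[|//]]]] _ h;
  rewrite /rc_plus /setU /=; tauto.
have r'_t i x : a (vr' i) x -> a vT x -> False.
  by move=> r'x tx; apply: (notC_disjoint notr't (x := x)) => //; apply: inords; exists i.
have r'_next i x : a (vr' i) x -> a (vr (shift4 i 1)) x -> a (vr' (shift4 i 1)) x.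
  move=> r'x /r_split [//|qx]; exfalso.
  by apply: (notC_disjoint (notr'q i) (x := x)); left.
have covr x : exists i, a (vr i) x.
  have : setT x by []. 
  rewrite -cov => -[[[h|h]|h]|h]; by [exists (inord 0)|exists (inord 1)|exists (inord 2)|exists (inord 3)].
have [tp tpP] : a vT !=set0 by exact/set0P/eqP.
(* The connected sets of (4) cover the space and all contain [tp]. *)
have cT : connected [set: T].
  have -> : [set: T] = \bigcup_(i in [set: 'I_4])
      rc_plus (rc_plus (a (vr' i)) (a (vr (shift4 i 1)))) (a vT).
    apply/seteqP; split=> x // _; have [i ri] := covr x.
    (* Modulo 4, adding 3 gives the predecessor, whose set in (4) contains [r i]. *)
    exists (shift4 i 3) => //; left; right.
    suff -> : shift4 (shift4 i 3) 1 = i by [].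
    rewrite (oI i) !oS -addnA; apply: val_inj; rewrite /= !oE.
    by rewrite modnDr.
  apply: bigcup_connected => [|i _]; last exact: cr.
  by exists tp => i _; right.
(* The premise stands under the existential so that [choice] yields a total function; where it
   fails, [p] itself is a dummy value. *)
have step (kp : nat * T) : exists q, a (vr' (o kp.1)) kp.2 ->
    connected_component (a (vr (o kp.1))) kp.2 q /\ a (vr' (o kp.1.+1)) q.
  case: kp => k p /=; have [r'p|] := pselect (a (vr' (o k)) p); last by exists p.
  set C := connected_component _ p.
  have clC : closed C by exact: component_closed.
  have [[q [[r'q Cq] rq]]|none] :=
      pselect ((a (vr' (o k)) `&` C) `&` a (vr (o k.+1)) !=set0).
    exists q => _; split=> //; rewrite -addn1 -oS; apply: r'_next => //.
    by rewrite oS addn1.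
  (* Without such a [q], the part of [r'] inside [C] would be separated from the rest of the
     connected set of (4). That whole set, including the point [tp] of [t], would then lie in [r'],
     against (5). *)
  exfalso; apply: (@r'_t (o k) tp) => //.
  have := cr (o k); rewrite oS addn1 => ck.
  have clD : closed (a (vr (o k)) `\` C) by exact: closed_setD_component.
  suff : rc_plus (rc_plus (a (vr' (o k))) (a (vr (o k.+1)))) (a vT) `<=`
      a (vr' (o k)) `&` C by move=> /(_ tp) []; first by right.
  apply: (connected_sub_closed ck _
    (C := (a (vr' (o k)) `&` (a (vr (o k)) `\` C)) `|` a (vr (o k.+1)) `|` a vT)).
  - exact: closedI.
  - by do !apply: closedU => //; exact: closedI.
  - move=> z [[r'z|rz]|tz]; [|by right; left; right|by right; right].
    have [Cz|nCz] := pselect (C z); [by left|right; left; left].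
    by split=> //; split=> //; exact: r'_r.
  - apply/seteqP; split=> z // [[_ [r'z Cz]] [[[_ [_ /(_ Cz)]]//|rz]|tz]].
      by apply: none; exists z.
    exact: r'_t r'z tz.
  - exists p; split; first by left; left.
    by split=> //; apply: connected_component_refl; exact: r'_r.
have [f fP] := choice step.
have [p0 r'p0] : a (vr' (o 0)) !=set0 by apply/set0P/eqP; exact: (r'r (o 0)).1.
pose p := nat_rect (fun=> T) p0 (fun k q => f (k, q)).
have r'p k : a (vr' (o k)) (p k).
  by elim: k => // k IH; have [] := fP (k, p k) IH.
have cp k : connected_component (a (vr (o k))) (p k) (p k.+1).
  by have [] := fP (k, p k) (r'p k).
(* The contact point of stages [k] and [k.+1] is [p k.+1]: it is reached inside the component of
   [p k] and starts the next stage. *)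
apply: (@no_infinite_walk T lcT uT cT (fun k => a (vr (o k))) _ _ _ _ _ (fun k => p k.+1)) => //.
- by move=> m n mn; rewrite /o mn.
(* Since [r_dis] speaks of indices below 2, the two sets exchange roles when [n] reduces to 2 or
   3. *)
- move=> m n x mn; have [n2|n2] := ltnP (n %% 4) 2.
    move=> rm rn; apply: (r_dis (o n) x) => //; first by rewrite oE.
    by rewrite oS /o -mn.
  move=> rm rn; apply: (r_dis (o m) x) => //; first by rewrite oE; lia.
  by rewrite oS /o (_ : (m + 2) %% 4 = n %% 4) //; lia.
- move=> k x; have [i ri] := covr x; rewrite (oI i) in ri.
  have /orP[/orP[/eqP e|/eqP e]|/orP[/eqP e|/eqP e]] :
    (i %% 4 == k %% 4) || (i %% 4 == k.+1 %% 4) ||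
    ((i %% 4 == k.+2 %% 4) || (i %% 4 == k.+3 %% 4)) by lia.
  + by apply: Or41; move: ri; rewrite /o e.
  + by apply: Or42; move: ri; rewrite /o e.
  + by apply: Or43; move: ri; rewrite /o e.
  + by apply: Or44; move: ri; rewrite /o e.
- by move=> k /=; apply: connected_component_sub (cp k).
- by move=> k /=; apply: connected_component_sym; exact: (cp k.+1).
Qed.

(** * Unions of unit squares *)

Section Grid.
Variables (R : realType) (n : nat).
Local Notation T := 'rV[R]_n.+2.
Implicit Types (c d : int * int) (S : set (int * int)) (x y : T).

Definition abscissa x : R := x ord0 ord0.
Definition ordinate x : R := x ord0 (lift ord0 ord0).

(** The coordinates after the second are left free, so one plane diagram serves every dimension. *)
Definition cell c : set T := [set x |
  (c.1%:~R <= abscissa x <= c.1%:~R + 1)%R /\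
  (c.2%:~R <= ordinate x <= c.2%:~R + 1)%R].

Definition open_cell c : set T := [set x |
  (c.1%:~R < abscissa x < c.1%:~R + 1)%R /\
  (c.2%:~R < ordinate x < c.2%:~R + 1)%R].

Definition region S : set T := \bigcup_(c in S) cell c.

Definition near_cells c d : Prop :=
  (`|c.1 - d.1| <= 1)%R /\ (`|c.2 - d.2| <= 1)%R.

Definition point (u v : R) : T :=
  (\row_j if j == ord0 then u else v)%R.

Definition corner c : T := point c.1%:~R c.2%:~R.

Lemma abscissa_point u v : abscissa (point u v) = u.
Proof. by rewrite /abscissa mxE. Qed.

Lemma ordinate_point u v : ordinate (point u v) = v.
Proof. by rewrite /ordinate mxE. Qed.

Lemma continuous_abscissa : continuous abscissa.
Proof. exact: (@coord_continuous R 1 n.+2 ord0 ord0). Qed.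

Lemma continuous_ordinate : continuous ordinate.
Proof. exact: (@coord_continuous R 1 n.+2 ord0 (lift ord0 ord0)). Qed.

Lemma cell_cover x : exists c, cell c x.
Proof.
have itv (u : R) : ((Num.floor u)%:~R <= u <= (Num.floor u)%:~R + 1)%R.
  by have /andP[-> /ltW] := floor_itv u; rewrite intrD.
by exists (Num.floor (abscissa x), Num.floor (ordinate x)); split; exact: itv.
Qed.

Lemma open_cell_sub c : open_cell c `<=` cell c.
Proof. by move=> x [/andP[/ltW a /ltW b] /andP[/ltW d /ltW e]]; split; apply/andP. Qed.

Lemma open_open_cell c : open (open_cell c).
Proof.
rewrite openE => x [/andP[a1 a2] /andP[b1 b2]]; rewrite /interior /=.
near=> y; split; apply/andP; split; near: y.
- exact: cvgr_gt (continuous_abscissa (x := x)) _ a1.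
- exact: cvgr_lt (continuous_abscissa (x := x)) _ a2.
- exact: cvgr_gt (continuous_ordinate (x := x)) _ b1.
- exact: cvgr_lt (continuous_ordinate (x := x)) _ b2.
Unshelve. all: by end_near. Qed.

Lemma open_cell_inj c d x : open_cell c x -> cell d x -> c = d.
Proof.
have inj (i j : int) (u : R) : (i%:~R < u < i%:~R + 1)%R ->
    (j%:~R <= u <= j%:~R + 1)%R -> i = j.
  move=> /andP[i1 i2] /andP[j1 j2].
  have : (i < j + 1)%R by rewrite -(ltr_int R) intrD; exact: lt_le_trans i1 j2.
  have : (j < i + 1)%R by rewrite -(ltr_int R) intrD; exact: le_lt_trans j1 i2.
  lia.
case: c d => [c1 c2] [d1 d2] [/= a b] [/= a' b'].
by rewrite (inj _ _ _ a a') (inj _ _ _ b b').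
Qed.

(** The neighbourhood is uniform in [d]; this local finiteness makes arbitrary unions of cells
    closed. *)
Lemma near_cell x : \forall y \near x, forall d, cell d y -> cell d x.
Proof.
(* Strictly between [ceil u - 1] and [floor u + 1] there is no integer except possibly [u]. *)
have itv (i : int) (u v : R) : (v < (Num.floor u + 1)%:~R)%R ->
    ((Num.ceil u - 1)%:~R < v)%R -> (i%:~R <= v <= i%:~R + 1)%R ->
    (i%:~R <= u <= i%:~R + 1)%R.
  move=> h1 h2 /andP[v1 v2]; apply/andP; split.
    rewrite -floor_ge_int.
    by have := le_lt_trans v1 h1; rewrite ltr_int ltzD1.
  have -> : (i%:~R + 1 = (i + 1)%:~R :> R)%R by rewrite intrD.
  rewrite -ceil_le_int.
  have : ((Num.ceil u - 1)%:~R < (i + 1)%:~R :> R)%R.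
    by rewrite [X in (_ < X)%R]intrD; exact: lt_le_trans h2 v2.
  by rewrite ltr_int ltrBlDr ltzD1 => /le_trans; apply.
near=> y.
move=> d [a b]; split.
- apply: (itv _ _ (abscissa y)) => //; near: y.
    exact: cvgr_lt (continuous_abscissa (x := x)) _ (floorD1_gt _).
  exact: cvgr_gt (continuous_abscissa (x := x)) _ (ceilB1_lt _).
- apply: (itv _ _ (ordinate y)) => //; near: y.
    exact: cvgr_lt (continuous_ordinate (x := x)) _ (floorD1_gt _).
  exact: cvgr_gt (continuous_ordinate (x := x)) _ (ceilB1_lt _).
Unshelve. all: by end_near. Qed.

Let seg x y (e : R) : T := (x + e *: (y - x))%R.

Let continuous_seg x y : continuous (seg x y).
Proof.
move=> e; apply: (@continuousD R T R).
  exact: cst_continuous.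
exact: scalel_continuous.
Qed.

Let abscissa_seg x y e : abscissa (seg x y e) =
  (abscissa x + e * (abscissa y - abscissa x))%R.
Proof. by rewrite /abscissa !mxE. Qed.

Let ordinate_seg x y e : ordinate (seg x y e) =
  (ordinate x + e * (ordinate y - ordinate x))%R.
Proof. by rewrite /ordinate !mxE. Qed.

Lemma connected_cell c : connected (cell c).
Proof.
pose x0 : T := corner c.
have x0c : cell c x0.
  by split; rewrite /= ?abscissa_point ?ordinate_point lexx /= lerDl.
(* A cell is star-shaped around its corner. *)
have -> : cell c = \bigcup_(y in cell c) (seg x0 y @` `[0%R, 1%R]).
  apply/seteqP; split=> [y cy|_ [y [a b]] [e /= +] <-].
    exists y => //; exists 1%R => /=; first by rewrite in_itv /= ler01 lexx.
    by rewrite /seg scale1r addrC subrK.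
  rewrite in_itv /= => /andP[e0 e1].
  rewrite /cell /= abscissa_seg ordinate_seg.
  by rewrite /x0 abscissa_point ordinate_point; split; nra.
apply: bigcup_connected.
  exists x0 => y _; exists 0%R => /=; first by rewrite in_itv /= ler01 lexx.
  by rewrite /seg scale0r addr0.
move=> y _; apply: connected_continuous_connected.
  exact: segment_connected.
exact/continuous_subspaceT/continuous_seg.
Qed.

Lemma cell_sub_closure c : cell c `<=` closure (open_cell c).
Proof.
move=> x [a b] B nB.
(* A small move from [x] towards this central point makes all four inequalities strict. *)
pose z : T := point (c.1%:~R + 1/2) (c.2%:~R + 1/2).
have /cvg_at_right_filter nBz : seg x z @ 0%R --> x.
  have {2}-> : x = seg x z 0%R by rewrite /seg scale0r addr0.
  exact: continuous_seg.
have [e [[e0 e1] Be]] : exists e : R, (0 < e /\ e < 1)%R /\ B (seg x z e).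
  apply: (@filter_ex _ (0%R : R)^'+).
  near=> e; split; first by split; near: e; [exact: nbhs_right_gt|exact: nbhs_right_lt].
  near: e; exact: (nBz _ nB).
exists (seg x z e); split=> //.
rewrite /open_cell /= abscissa_seg ordinate_seg abscissa_point ordinate_point.
split; nra.
Unshelve. all: by end_near. Qed.

Lemma region_closed S : closed (region S).
Proof.
move=> x clx; have [y [[c Sc cy] /(_ c cy) cx]] := clx _ (near_cell x).
by exists c.
Qed.

Lemma region_setT : region setT = setT.
Proof. by apply/seteqP; split=> // x _; have [c cx] := cell_cover x; exists c. Qed.

Lemma corner_cell c : cell c (corner c).
Proof. by split; rewrite /= ?abscissa_point ?ordinate_point lexx /= lerDl. Qed.

Lemma region_corner S c : S c -> region S (corner c).
Proof. by move=> Sc; exists c => //; exact: corner_cell. Qed.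

Lemma region_plus S S' : rc_plus (region S) (region S') = region (S `|` S').
Proof. by rewrite /region bigcup_setU. Qed.

Lemma region_mul S S' : rc_mul (region S) (region S') = region (S `&` S').
Proof.
apply/seteqP; split; last first.
  move=> x [c [Sc S'c] /cell_sub_closure]; apply: closureS.
  rewrite -open_subsetE; last exact: open_open_cell.
  by move=> y /open_cell_sub cy; split; exists c.
rewrite /rc_mul [X in _ `<=` X](closure_id _).1; last exact: region_closed.
apply: closureS => x ix.
have [y [[c Sc cy] _]] := interior_subset ix.
have [c' c'x] := cell_cover x.
(* The open cell of [c'] has a point in both regions, and such a point belongs to no cell but
   [c']. *)
have [z [c'z [[d Sd dz] [d' Sd' d'z]]]] := cell_sub_closure c'x ix.
exists c' => //; split.
  by rewrite (open_cell_inj c'z dz).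
by rewrite (open_cell_inj c'z d'z).
Qed.

Lemma region_neg S : rc_neg (region S) = region (~` S).
Proof.
apply/seteqP; split; last first.
  move=> x [c nSc /cell_sub_closure]; apply: closureS.
  by move=> y cy [d Sd /(open_cell_inj cy) e]; apply: nSc; rewrite e.
rewrite /rc_neg [X in _ `<=` X](closure_id _).1; last exact: region_closed.
apply: closureS => x nSx; have [c cx] := cell_cover x.
by exists c => // Sc; apply: nSx; exists c.
Qed.

Lemma region_regular S : regular_closed (region S).
Proof. by have := region_mul S S; rewrite /rc_mul !setIid. Qed.

Lemma region_disjoint S S' x :
  (forall c d, S c -> S' d -> ~ near_cells c d) ->
  region S x -> region S' x -> False.
Proof.
have itv (i j : int) (u : R) : (i%:~R <= u <= i%:~R + 1)%R ->
    (j%:~R <= u <= j%:~R + 1)%R -> (`|i - j| <= 1)%R.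
  move=> /andP[i1 i2] /andP[j1 j2].
  have : (i <= j + 1)%R by rewrite -(ler_int R) intrD; exact: le_trans i1 j2.
  have : (j <= i + 1)%R by rewrite -(ler_int R) intrD; exact: le_trans j1 i2.
  lia.
move=> far [c Sc [c1 c2]] [d Sd [d1 d2]]; apply: (far c d Sc Sd).
by split; [exact: itv c1 d1|exact: itv c2 d2].
Qed.

Lemma region_neq0 S : S !=set0 -> region S <> set0.
Proof. by move=> [c /region_corner Sc]; apply/eqP/set0P; exists (corner c). Qed.

Lemma not_connectedU (A B : set T) : closed A -> closed B ->
  (forall x, A x -> B x -> False) -> A !=set0 -> B !=set0 ->
  ~ connected (A `|` B).
Proof.
move=> clA clB dis [x Ax] [y By] c.
have : A `|` B `<=` A.
  apply: (connected_sub_closed c clA clB) => //; last by exists x; split=> //; left.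
  by apply/seteqP; split=> // z [[_ Az] Bz]; exact: dis Az Bz.
by move=> /(_ y) Ay; apply: (dis y) => //; apply: Ay; right.
Qed.

Lemma region_notC S S' : connected (region S) -> connected (region S') ->
  S !=set0 -> S' !=set0 -> (forall c d, S c -> S' d -> ~ near_cells c d) ->
  notC (region S) (region S').
Proof.
move=> cS cS' [c Sc] [c' Sc'] far; split=> //; split=> //.
apply: not_connectedU; try exact: region_closed.
- by move=> x; exact: region_disjoint.
- by exists (corner c); exact: region_corner.
- by exists (corner c'); exact: region_corner.
Qed.

(** Each cell is connected and is represented by its corner, which reduces connectedness of a region
    to paths of indices. *)
Definition joined S c d : Prop :=
  connected_component (region S) (corner c) (corner d).

Lemma joined_sym S c d : joined S c d -> joined S d c.
Proof. exact: connected_component_sym. Qed.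

Lemma joined_trans S c d e : joined S c d -> joined S d e -> joined S c e.
Proof. exact: connected_component_trans. Qed.

Lemma joined_near S c d : S c -> S d -> near_cells c d -> joined S c d.
Proof.
move=> Sc Sd [n1 n2]; exists (cell c `|` cell d); last by right; exact: corner_cell.
split.
- by left; exact: corner_cell.
- by move=> x [cx|dx]; [exists c|exists d].
apply: connectedU; try exact: connected_cell.
(* The coordinatewise maximum of the two corners lies in both cells; diagonal contact suffices. *)
exists (point (Num.max c.1 d.1)%:~R (Num.max c.2 d.2)%:~R).
have itv (i j : int) : (`|i - j| <= 1)%R ->
  (i%:~R <= ((Num.max i j)%:~R : R) <= i%:~R + 1)%R /\
  (j%:~R <= ((Num.max i j)%:~R : R) <= j%:~R + 1)%R.
  move=> ij; have e (k : int) : (k%:~R + 1 = (k + 1)%:~R :> R)%R by rewrite intrD.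
  by rewrite !e !ler_int; lia.
have [a a'] := itv _ _ n1; have [b b'] := itv _ _ n2.
by split; split; rewrite /= ?abscissa_point ?ordinate_point.
Qed.

Lemma joined_subset S S' c d : S `<=` S' -> joined S c d -> joined S' c d.
Proof.
move=> SS' [B [Bc BS cB] Bd]; exists B => //; split=> //.
by apply: subset_trans BS _; exact: bigcup_subset.
Qed.

Lemma joined_path S (f : nat -> int * int) m :
  (forall k, k <= m -> S (f k)) ->
  (forall k, k < m -> near_cells (f k) (f k.+1)) -> joined S (f 0) (f m).
Proof.
elim: m => [|m IH] Sf nf.
  by apply: connected_component_refl; apply: region_corner; exact: Sf.
apply: (@joined_trans _ _ (f m)).
  apply: IH => k km; [exact: Sf (leqW km)|exact: nf (leqW km)].
by apply: joined_near; [exact: Sf|exact: Sf|exact: nf].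
Qed.

Lemma joined_row S (a a' b : int) : (a <= a')%R ->
  (forall i, (a <= i <= a')%R -> S (i, b)) -> joined S (a, b) (a', b).
Proof.
move=> aa' Sr.
have := @joined_path S (fun k => (a + k%:Z, b)%R) `|a' - a|%N.
rewrite addr0 gez0_abs ?subr_ge0// (addrC a) subrK; apply.
  by move=> k km; apply: Sr; lia.
by move=> k km; split=> /=; lia.
Qed.

Lemma joined_column S (a b b' : int) : (b <= b')%R ->
  (forall i, (b <= i <= b')%R -> S (a, i)) -> joined S (a, b) (a, b').
Proof.
move=> bb' Sr.
have := @joined_path S (fun k => (a, b + k%:Z)%R) `|b' - b|%N.
rewrite addr0 gez0_abs ?subr_ge0// (addrC b) subrK; apply.
  by move=> k km; apply: Sr; lia.
by move=> k km; split=> /=; lia.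
Qed.

Lemma region_connected S c : S c -> (forall d, S d -> joined S d c) ->
  connected (region S).
Proof.
move=> Sc jS; suff -> : region S = connected_component (region S) (corner c).
  exact: component_connected.
apply/seteqP; split; last exact: connected_component_sub.
move=> x [d Sd dx].
apply: connected_component_trans (joined_sym (jS d Sd)) _.
exists (cell d) => //; split; [exact: corner_cell| |exact: connected_cell].
by move=> y dy; exists d.
Qed.

End Grid.

(** * The plane region diagram *)

Section Rings.
Implicit Types (i j : nat) (c d : int * int) (S : set (int * int)).

(** The sup norm, whose level sets are the square rings; ring 0 is the single cell [(0, 0)]. *)
Definition ring_index c : nat := maxn `|c.1|%N `|c.2|%N.

Definition rings i : set (int * int) := [set c | ring_index c = i %[mod 4]].

(* [caps i] interprets [r'_i] and [cups i] interprets [r_i . (- r'_i)].  The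
   bound on the ordinate drops by one from each ring to the next, so that a cap
   touches the next ring only inside the cap of that ring. *)
Definition caps i : set (int * int) :=
  [set c | ring_index c = i %[mod 4] /\ (2 <= c.2 + (ring_index c)%:Z)%R].

Definition cups i : set (int * int) := rings i `&` ~` caps i.

Definition on_side i : set (int * int) :=
  [set c | if i < 2 then (c.1 <= -1)%R else (1 <= c.1)%R].

(* The parts of the rings [i mod 4] through which the cross-ring rays of [s_i]
   and [t_i] reach caps and cups: left halves for [i < 2], right halves
   otherwise, which keeps [s_i], [t_i] away from [s_(i+2)], [t_(i+2)]. *)
Definition sides i : set (int * int) :=
  [set c | [/\ ring_index c = i %[mod 4], on_side i c & (c.2 <= 1)%R]].

(** The start -1 keeps the ray off the cap of ring 1, which lies at ordinate 1. *)
Definition down_ray : set (int * int) := [set c | c.1 = 0%R /\ (c.2 <= -1)%R].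

(** The start 2 keeps the ray off the cups of rings 0 and 1, which reach ordinate 0. *)
Definition up_ray : set (int * int) := [set c | c.1 = 0%R /\ (2 <= c.2)%R].

(** Cells of columns -1 and 1 never touch, which keeps opposite foot rays apart. *)
Definition foot i : int := if i < 2 then (-1)%R else 1%R.

Definition foot_ray i : set (int * int) :=
  [set c | c.1 = foot i /\ (c.2 <= -2)%R].

(** On the right the ray starts at 3 because the cups of rings 0 and 1 contain [(0, 0)] and
    [(1, 0)], which touch cells of ordinate 1 up to abscissa 2. *)
Definition side_ray i : set (int * int) :=
  [set c | (if i < 2 then (c.1 <= -1)%R else (3 <= c.1)%R) /\ c.2 = 1%R].

Definition cells (v : var) : set (int * int) :=
  match v with
  | vr i => rings i
  | vr' i => caps i
  | vs i => sides i `|` foot_ray i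
  | vt i => sides i `|` side_ray i
  | vS => up_ray
  | vT => down_ray
  end.

Lemma cupsE c i :
  cups i c <-> ring_index c = i %[mod 4] /\ (c.2 + (ring_index c)%:Z <= 1)%R.
Proof.
split=> [[rc nc]|[rc h]].
  by split=> //; rewrite leNgt; apply/negP => h; apply: nc; split=> //; lia.
by split=> // -[_]; lia.
Qed.

Ltac cell_arith :=
  unfold rings, ring_index, mkset in *; cbn beta iota delta [fst snd] in *; lia.

(** Ring indices of touching cells differ by at most one. For a cup and a cap this excludes an
    offset of 2; in the other case the cup is one ring further out, so its ordinates stay at least 2
    below those of the cap. *)
Lemma cup_down_ray_far_cap_up_ray i j c d :
  j = i + 2 %[mod 4] \/ i = j + 1 %[mod 4] ->
  (cups i `|` down_ray) c -> (caps j `|` up_ray) d -> ~ near_cells c d.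
Proof.
move: c d => [x y] [z w] ij cc dd [/= n1 n2]; move: cc dd => [/cupsE|] cc [] dd.
- move: cc dd => [/= e1 h1] [/= e2 h2]; case: ij => ij; cell_arith.
- move: cc dd => [/= e1 h1] [/= e2 h2]; cell_arith.
- move: cc dd => [/= e1 h1] [/= e2 h2]; cell_arith.
- move: cc dd => [/= e1 h1] [/= e2 h2]; cell_arith.
Qed.

Lemma cap_foot_far i j c d : i < 2 -> j = i + 2 ->
  (caps i `|` (sides i `|` foot_ray i)) c ->
  (caps j `|` (sides j `|` foot_ray j)) d -> ~ near_cells c d.
Proof.
move: c d => [x y] [z w] i2 ij cc dd [/= n1 n2]; subst j.
rewrite /caps /sides /foot_ray /on_side /foot /= i2 in cc.
rewrite /caps /sides /foot_ray /on_side /foot /= (_ : (i + 2 < 2) = false) in dd; last by lia.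
move: cc dd => [[e1 h1]|[[e1 h1 h1']|[e1 h1]]] [[e2 h2]|[[e2 h2 h2']|[e2 h2]]]; cell_arith.
Qed.

Lemma cup_side_far i j c d : i < 2 -> j = i + 2 ->
  (cups i `|` (sides i `|` side_ray i)) c ->
  (cups j `|` (sides j `|` side_ray j)) d -> ~ near_cells c d.
Proof.
move: c d => [x y] [z w] i2 ij cc dd [/= n1 n2]; subst j.
rewrite /sides /side_ray /on_side /= i2 in cc.
rewrite /sides /side_ray /on_side /= (_ : (i + 2 < 2) = false) in dd; last by lia.
move: cc dd => [/cupsE [e1 h1]|[[e1 h1 h1']|[e1 h1]]] [/cupsE [e2 h2]|[[e2 h2 h2']|[e2 h2]]]; cell_arith.
Qed.

Lemma cap_far_down_ray c d : (exists i, caps i c) -> down_ray d -> ~ near_cells c d.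
Proof.
move: c d => [x y] [z w] [i [/= e1 h1]] [/= e2 h2] [/= n1 n2]; cell_arith.
Qed.

(** * Connectedness of the regions of the diagram *)

Variables (R : realType) (n : nat).
Local Notation joined := (@joined R n).
Local Notation region := (@region R n).

Lemma joined_row2 S (a a' b : int) :
  (forall z, (a <= z <= a')%R || (a' <= z <= a)%R -> S (z, b)) ->
  joined S (a, b) (a', b).
Proof.
move=> h; have [aa'|aa'] := lerP a a'.
  by apply: joined_row => // z hz; apply: h; rewrite hz.
by apply: joined_sym; apply: joined_row => [|z hz]; [exact: ltW|apply: h; rewrite hz orbT].
Qed.

Lemma joined_column2 S (a b b' : int) :
  (forall z, (b <= z <= b')%R || (b' <= z <= b)%R -> S (a, z)) ->
  joined S (a, b) (a, b').
Proof.
move=> h; have [bb'|bb'] := lerP b b'.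
  by apply: joined_column => // z hz; apply: h; rewrite hz.
by apply: joined_sym; apply: joined_column => [|z hz]; [exact: ltW|apply: h; rewrite hz orbT].
Qed.

(** A cell of a cap is on the top row or on a side column, so climbing its column stays in the
    cap. *)
Lemma joined_cap_top i c : caps i c -> joined (caps i) c (0, (ring_index c)%:Z)%R.
Proof.
move: c => [x y] [/= e h]; apply: (@joined_trans _ _ _ _ (x, (ring_index (x, y))%:Z)%R).
  by apply: joined_column2 => z hz; split; cell_arith.
by apply: joined_row2 => z hz; split; cell_arith.
Qed.

Lemma joined_cup_bottom i c : cups i c -> joined (cups i) c (0, - (ring_index c)%:Z)%R.
Proof.
move: c => [x y] /cupsE [/= e h]; apply: (@joined_trans _ _ _ _ (x, - (ring_index (x, y))%:Z)%R).
  by apply: joined_column2 => z hz; apply/cupsE; split; cell_arith.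
by apply: joined_row2 => z hz; apply/cupsE; split; cell_arith.
Qed.

Lemma joined_ring_bottom i c : rings i c -> joined (rings i) c (0, - (ring_index c)%:Z)%R.
Proof.
move: c => [x y] /= e; set k : int := ring_index (x, y).
have side u v : (`|u| = k)%R -> (`|v| <= k)%R -> joined (rings i) (u, v) (0%R, - k)%R.
  move=> uk vk; apply: (@joined_trans _ _ _ _ (u, - k)%R).
    by apply: joined_column2 => z hz; rewrite /k in uk vk hz *; cell_arith.
  by apply: joined_row2 => z hz; rewrite /k in uk vk hz *; cell_arith.
have [yk|yk] := eqVneq y k; last first.
  have [xk|xk] := eqVneq `|x|%R k; first by apply: side => //; rewrite /k; cell_arith.
  have -> : y = (- k)%R by rewrite /k in xk yk *; cell_arith.
  by apply: joined_row2 => z hz; rewrite /k in xk yk hz *; cell_arith.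
apply: (@joined_trans _ _ _ _ (k, k)).
  rewrite yk; apply: joined_row2 => z hz; rewrite /k in yk hz *; cell_arith.
by apply: side; rewrite /k; cell_arith.
Qed.

Lemma joined_down_ray S (k : nat) : S (0, - k%:Z)%R ->
  joined (S `|` down_ray) (0, - k%:Z)%R (0, -1)%R.
Proof.
case: k => [|k] Sk.
  by apply: joined_near; [left|right|split].
by apply: joined_column2 => z hz; right; split; cell_arith.
Qed.

Lemma connected_down_ray : connected (region down_ray).
Proof.
apply: (@region_connected _ _ _ (0, -1)%R) => // -[x y] [/= -> h].
by apply: joined_column2 => z hz; split; cell_arith.
Qed.

Lemma connected_cups_down_ray i : connected (region (cups i `|` down_ray)).
Proof.
apply: (@region_connected _ _ _ (0, -1)%R); first by right.
move=> [x y] [cd|[/= -> h]]; last first.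
  by apply: joined_column2 => z hz; right; split; cell_arith.
apply: (joined_trans (joined_subset _ (joined_cup_bottom cd))); first by move=> ?; left.
apply: joined_down_ray; apply/cupsE; move: cd => /cupsE [e h]; split; cell_arith.
Qed.

Lemma connected_caps_up_ray i : connected (region (caps i `|` up_ray)).
Proof.
apply: (@region_connected _ _ _ (0, 2)%R); first by right.
move=> [x y] [cd|[/= -> h]]; last first.
  by apply: joined_column2 => z hz; right; split; cell_arith.
apply: (joined_trans (joined_subset _ (joined_cap_top cd))); first by move=> ?; left.
case: cd => /= e h.
(* The top [(0, 1)] of ring 1 is not on the ray but touches its first cell. *)
have [k1|k1] := eqVneq (ring_index (x, y)) 1.
  by rewrite k1; apply: joined_near; [left; split; cell_arith|right|split].
by apply: joined_column2 => z hz; right; split; cell_arith.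
Qed.

Lemma connected_cap_ring_down_ray i j : j = i + 1 %[mod 4] ->
  connected (region (caps i `|` rings j `|` down_ray)).
Proof.
move=> ij; apply: (@region_connected _ _ _ (0, -1)%R); first by right.
have ring c : rings j c -> joined (caps i `|` rings j `|` down_ray) c (0, -1)%R.
  move=> rc; apply: (joined_trans (joined_subset _ (joined_ring_bottom rc))).
    by move=> ? ?; left; right.
  apply: joined_down_ray; right; move: rc; case: c => x y rc; cell_arith.
move=> [x y] [[cd|]|[/= -> h]]; last first.
- by apply: joined_column2 => z hz; right; split; cell_arith.
- exact: ring.
set k := ring_index (x, y).
(* The top of the cap of ring [k] touches ring [k.+1] in column 0. *)
have rk : rings j (0, k.+1%:Z)%R by case: cd => /= e h; rewrite /k; cell_arith.
apply: (joined_trans (joined_subset _ (joined_cap_top cd))); first by move=> ? ?; left; left.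
apply: joined_trans (ring _ rk); apply: joined_near.
- by left; left; case: cd => /= e h; split; cell_arith.
- by left; right.
- by split => /=; lia.
Qed.

Lemma connected_all_caps : connected (region [set c | exists i, caps i c]).
Proof.
apply: (@region_connected _ _ _ (0, 1)%R); first by exists 1.
move=> [x y] [i cd].
apply: (joined_trans (joined_subset _ (joined_cap_top cd))); first by move=> ? ?; exists i.
case: cd => /= e h.
(* The tops of the caps of rings 1, 2, and so on fill column 0 upwards from ordinate 1. *)
by apply: joined_column2 => z hz; exists `|z|%N; split; cell_arith.
Qed.

Lemma joined_side_foot i c : sides i c ->
  joined (sides i) c (foot i, - (ring_index c)%:Z)%R.
Proof.
move: c => [x y] [/= e]; rewrite /sides /on_side /foot /= => s h.
case: (ltnP i 2) s => _ s.
  apply: (@joined_trans _ _ _ _ (x, - (ring_index (x, y))%:Z)%R).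
    by apply: joined_column2 => z hz; split; cell_arith.
  by apply: joined_row2 => z hz; split; cell_arith.
apply: (@joined_trans _ _ _ _ (x, - (ring_index (x, y))%:Z)%R).
  by apply: joined_column2 => z hz; split; cell_arith.
by apply: joined_row2 => z hz; split; cell_arith.
Qed.

Lemma connected_caps_sides_foot_ray i :
  connected (region (caps i `|` (sides i `|` foot_ray i))).
Proof.
apply: (@region_connected _ _ _ (foot i, -2)%R); first by right; right.
have ray (k : nat) : 0 < k -> k = i %[mod 4] ->
    joined (caps i `|` (sides i `|` foot_ray i)) (foot i, - k%:Z)%R (foot i, -2)%R.
  move=> k0 ki; have [k1|k1] := eqVneq k 1.
    rewrite k1; apply: joined_near; [right; left|by right; right|by split; rewrite //= subrr].
    by rewrite /sides /on_side /foot /=; case: (ltnP i 2) => _; split; cell_arith.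
  by apply: joined_column2 => z hz; right; right; split => //; cell_arith.
have side c : sides i c ->
    joined (caps i `|` (sides i `|` foot_ray i)) c (foot i, -2)%R.
  move=> sc; apply: (joined_trans (joined_subset _ (joined_side_foot sc))).
    by move=> ? ?; right; left.
  move: c sc => [x y] [/= e]; rewrite /on_side /mkset => s h.
  by apply: ray; last exact: e; case: (ltnP i 2) s => _ s; cell_arith.
move=> [x y] [cd|[|[/= -> h]]]; last first.
- by apply: joined_column2 => z hz; right; right; split; cell_arith.
- exact: side.
apply: (joined_trans (joined_subset _ (joined_cap_top cd))); first by move=> ? ?; left.
case: cd => /= e h; set k := ring_index (x, y) in e h *.
have k0 : 0 < k by rewrite /k in e h *; cell_arith.
(* This is the lower outer corner of the ring. The path descends the outer column, whose cells are
   in the cap from ordinate [2 - k] on and in [sides i] below. *)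
have sk : sides i (foot i * k%:Z, - k%:Z)%R.
  by rewrite /sides /on_side /foot /=; case: (ltnP i 2) => _; split; clearbody k; cell_arith.
apply: joined_trans (side _ sk).
apply: (@joined_trans _ _ _ _ (foot i * k%:Z, k%:Z)%R).
  apply: joined_row2 => z hz; left; move: hz; rewrite /foot.
  by clearbody k; case: (ltnP i 2) => _ hz; split; cell_arith.
apply: joined_column2 => z hz.
have [zk|zk] := lerP 2 (z + k%:Z); [left|right; left].
  by rewrite /foot; clearbody k; case: (ltnP i 2) => _; split; cell_arith.
by rewrite /sides /on_side /foot /=; clearbody k; case: (ltnP i 2) => _; split; cell_arith.
Qed.

Definition side_root i : int * int := (if i < 2 then (-1)%R else 3%R, 1%R).

Lemma connected_cups_sides_side_ray i : i < 4 ->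
  connected (region (cups i `|` (sides i `|` side_ray i))).
Proof.
move=> i4; set S := _ `|` _.
have rootS : side_ray i (side_root i).
  by rewrite /side_ray /side_root /=; case: (ltnP i 2).
apply: (@region_connected _ _ _ (side_root i)); first by right; right.
have up (k : nat) y : 0 < k -> k = i %[mod 4] -> (`|y| <= k%:Z)%R -> (y <= 1)%R ->
    joined S (foot i * k%:Z, y)%R (side_root i).
  move=> k0 ki yk y1; apply: (@joined_trans _ _ _ _ (foot i * k%:Z, 1)%R).
    apply: joined_column2 => z hz; right; left.
    by rewrite /sides /on_side /foot /=; case: (ltnP i 2) => _; split; cell_arith.
  (* Ring 2 has its outer column at abscissa 2, one cell short of the ray, which starts at 3. *)
  rewrite /side_root; have [k2|k2] := eqVneq k 2.
    have i2 : i = 2 by lia.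
    subst k i; apply: joined_near; [right; left|right; right|]; split => //=.
  apply: joined_row2 => z hz; right; right; move: hz.
  by rewrite /side_ray /foot /=; case: (ltnP i 2) => i2 hz; split; cell_arith.
have side c : sides i c -> joined S c (side_root i).
  move=> sc; apply: (joined_trans (joined_subset _ (joined_side_foot sc))).
    by move=> ? ?; right; left.
  move: c sc => [x y] [/= e]; rewrite /on_side /mkset => s h.
  set k := ring_index (x, y) in e *.
  have k0 : 0 < k by rewrite /k; case: (ltnP i 2) s => _ s; cell_arith.
  apply: joined_trans (up k (- k%:Z)%R k0 e _ _); [|by lia|by lia].
  apply: joined_row2 => z; rewrite /foot => hz; right; left.
  rewrite /sides /on_side /=; clearbody k.
  by case: (ltnP i 2) hz => _ hz; split; cell_arith.
move=> [x y] [cd|[|[/=]]]; last first.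
- rewrite /side_root => s ->; apply: joined_row2 => z hz; right; right.
  by rewrite /side_ray /=; case: (ltnP i 2) s hz => _ s hz; split; cell_arith.
- exact: side.
apply: (joined_trans (joined_subset _ (joined_cup_bottom cd))); first by move=> ? ?; left.
move: cd => /cupsE [/= e h]; set k := ring_index (x, y) in e h *.
(* The single cell of ring 0 forces [i = 0] and touches the root [(-1, 1)] diagonally. *)
have [k0|k0] := posnP k.
  rewrite k0; apply: joined_near; [left|by right; right|].
    by apply/cupsE; split; clearbody k; cell_arith.
  by rewrite /side_root; case: (ltnP i 2) => i2; [split|lia].
apply: joined_trans (up k (- k%:Z)%R k0 e _ _); [|by lia|by lia].
apply: joined_row2 => z hz; left; apply/cupsE; move: hz; rewrite /foot.
by clearbody k; case: (ltnP i 2) => _ hz; split; cell_arith.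
Qed.

End Rings.

(** * The satisfying interpretation *)

Lemma phi_c_inf_satisfiable (R : realType) (n : nat) :
  exists a : var -> set 'rV[R]_n.+2, rc_interp a /\ phi_c_inf a.
Proof.
exists (fun v => region (cells v)); split; first by move=> v; exact: region_regular.
have cupE i : rc_mul (@region R n (rings i)) (rc_neg (region (caps i))) = region (cups i).
  by rewrite region_neg region_mul.
have capS0 i (S : set (int * int)) : caps i `|` S !=set0.
  (* Ring [4 + i] is used because ring 0 has no cap. *)
  by exists (0, (4 + i)%:Z)%R; left; rewrite /caps /ring_index /=; lia.
have cup0 i (S : set (int * int)) : cups i `|` S !=set0.
  exists (0, - (4 + i)%:Z)%R; left; apply/cupsE; rewrite /ring_index /=; lia.
have i4 (i : 'I_4) := ltn_ord i.
(* The two alternatives are the index relations of (2) and of (6). *)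
have notC_cup_cap (i j : nat) : j = i + 2 %[mod 4] \/ i = j + 1 %[mod 4] ->
    notC (@region R n (cups i `|` down_ray)) (region (caps j `|` up_ray)).
  move=> ij; apply: region_notC => //.
  - exact: connected_cups_down_ray.
  - exact: connected_caps_up_ray.
  - by move=> c d; exact: cup_down_ray_far_cap_up_ray.
have notC_sym (X Y : set 'rV[R]_n.+2) : notC X Y -> notC Y X.
  by move=> [cX [cY nc]]; split=> //; split=> //; rewrite /rc_plus setUC.
rewrite /phi_c_inf /=; split; [split|split; [|split; [|split; [|split; [|split]]]]].
- rewrite !region_plus -(@region_setT R n); congr region.
  apply/seteqP; split=> // c _; rewrite /rings /setU /= !inordK //; lia.
- move=> i j ij; rewrite region_mul (_ : _ `&` _ = set0) ?/region ?bigcup_set0//.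
  apply/seteqP; split=> // c []; rewrite /rings /=.
  move: (i4 i) (i4 j); lia.
- move=> i; apply: region_neq0; exists (0, (nat_of_ord i)%:Z)%R.
  by rewrite /rings /ring_index /= max0n.
- move=> i i2; rewrite !cupE !region_plus; split.
  + by apply: notC_cup_cap; left; rewrite /= modn_mod.
  + by apply/notC_sym/notC_cup_cap; left => /=; lia.
  + apply: region_notC => //.
    * exact: connected_caps_sides_foot_ray.
    * exact: connected_caps_sides_foot_ray.
    * by move=> c d; apply: cap_foot_far => //=; lia.
  + apply: region_notC => //.
    * exact: connected_cups_sides_side_ray.
    * by apply: connected_cups_sides_side_ray; rewrite ltn_mod.
    * by move=> c d; apply: cup_side_far => //=; lia.
- move=> i; split.
    apply: region_neq0; exists (0, (4 + i)%:Z)%R.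
    rewrite /caps /ring_index /=; lia.
  rewrite /rc_le region_mul; congr region.
  by apply/seteqP; split=> c; [case|move=> [e h]].
- by apply: region_neq0; exists (0, -1)%R.
- move=> i; rewrite !region_plus; apply: connected_cap_ring_down_ray.
  by rewrite /= modn_mod.
- rewrite !region_plus (_ : _ `|` _ = [set c | exists i, caps i c]).
    apply: region_notC.
    + exact: connected_all_caps.
    + exact: connected_down_ray.
    + by exists (0, 1)%R, 1.
    + by exists (0, -1)%R.
    + by move=> c d; exact: cap_far_down_ray.
  apply/seteqP; split=> c.
    by move=> [[[|]|]|] h; eexists; exact: h.
  move=> [i [e h]]; rewrite /caps /setU /= !inordK //; lia.
- move=> i; rewrite cupE !region_plus; apply/notC_sym/notC_cup_cap; right => /=.
  by rewrite modn_mod.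
Qed.

Theorem theorem3p3 (R : realType) :
  (forall n : nat, (2 <= n)%N ->
     exists a : var -> set 'rV[R]_n, rc_interp a /\ phi_c_inf a) /\
  (forall (T : topologicalType) (a : var -> set T),
     locally_connected_space T -> unicoherent T ->
     rc_interp a -> phi_c_inf a ->
     exists v : var, infinitely_many_components (a v)).
Proof.
split=> [[|[|n]] // _|]; first exact: phi_c_inf_satisfiable.
exact: phi_c_inf_infinitely_many_components.
Qed.
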